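(* Consider a $2n$-dimensional stochastic Hamiltonian system with additive noise $$dX(t)=J^{-1}\nabla H_0(t,X(t))\,dt+\sum_{r=1}^m g_r(t)\,dW_r(t),\qquad X(t)=(P(t),Q(t))^\top\in\mathbb{R}^{n}\times\mathbb{R}^n,$$ where $J=\begin{pmatrix}0&I_n\\-I_n&0\end{pmatrix}$, $H_0$ is the (differentiable) Hamiltonian, $W_1,\dots,W_m$ are independent standard Wiener processes, and the noise coefficients $g_r(t)=J^{-1}\nabla H_r$ do not depend on $X$. Put $f(t,x)=J^{-1}\nabla H_0(t,x)$ and apply the $s$-stage stochastic Runge--Kutta method $$Y_i = y_k + h\sum_{j=1}^{s} a_{ij} f(t_k+c_j h, Y_j) + \sum_{r=1}^{m} I_r \sum_{j=1}^{s}b_{ij}\,g_r(t_k+\widehat{c}_j h) + \sum_{r=1}^{m} \frac{I_{r0}}{h} \sum_{j=1}^{s}d_{ij}\,g_r(t_k+\widehat{c}_j h),\quad i=1,\dots,s,$$ $$y_{k+1} = y_k + h\sum_{i=1}^{s} \alpha_{i} f(t_k+c_i h, Y_i) + \sum_{r=1}^{m} I_r \sum_{i=1}^{s}\beta_{i}\,g_r(t_k+\widehat{c}_i h) + \sum_{r=1}^{m} \frac{I_{r0}}{h} \sum_{i=1}^{s}\gamma_{i}\,g_r(t_k+\widehat{c}_i h),$$ with $y_k=(P_k,Q_k)^\top$ and real coefficients $a_{ij},b_{ij},d_{ij},\alpha_i,\beta_i,\gamma_i,c_i,\widehat c_i$. If $$\alpha_i a_{ij}+\alpha_j a_{ji}=\alpha_i\alpha_j\qquad\text{for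 all } i,j=1,\dots,s,$$ then the method is symplectic.
   Context: Here $t_k=kh$, $I_r=W_r(t_{k+1})-W_r(t_k)$ and $I_{r0}=\int_{t_k}^{t_{k+1}}\int_{t_k}^{s}dW_r(u)\,ds$. Gradients are with respect to $x=(p,q)$. A method producing approximations $\{(P_k,Q_k)\}$ is called symplectic if $dP_{k+1}\wedge dQ_{k+1}=dP_k\wedge dQ_k$, where $dp\wedge dq=\sum_{i=1}^n dp^i\wedge dq^i$; that is, for each realization of the random increments, the one-step map $(P_k,Q_k)\mapsto(P_{k+1},Q_{k+1})$ defined by the method preserves this standard 2-form.
   Formalization: The Hamiltonian H_0 is taken to be twice differentiable in x (its gradient is differentiable), and the one-step map is any branch on an open set whose stages Y_i depend differentiably on y_k, so that dP_{k+1} and dQ_{k+1} make sense. *)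

(* Defs.v *)
From HB Require Import structures.
From mathcomp Require Import all_boot all_order all_algebra.
From mathcomp Require Import all_classical all_reals all_analysis.

Set Implicit Arguments.
Unset Strict Implicit.
Unset Printing Implicit Defensive.

Import Order.TTheory GRing.Theory Num.Theory.
Import numFieldNormedType.Exports.

Local Open Scope classical_set_scope.
Local Open Scope ring_scope.

Section Hamiltonian.
Context {R : realType} {n : nat}.

(* In 'cV_(n + n), coordinate i of p has index lshift n i and coordinate i of q
   has index rshift n i. *)

Definition Jmx : 'M[R]_(n + n) := block_mx 0 1%:M (- 1%:M) 0.

Definition gradient (H : 'cV[R]_(n + n) -> R) (x : 'cV[R]_(n + n)) :
    'cV[R]_(n + n) :=
  \col_i 'D_(delta_mx i 0) H x.

Definition hamiltonian_field (H : 'cV[R]_(n + n) -> R) (x : 'cV[R]_(n + n)) :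
    'cV[R]_(n + n) :=
  invmx Jmx *m gradient H x.

(* dp /\ dq evaluated on two tangent vectors *)
Definition wedge_pq (v w : 'cV[R]_(n + n)) : R :=
  \sum_(i < n) (v (lshift n i) 0 * w (rshift n i) 0
              - w (lshift n i) 0 * v (rshift n i) 0).

(* The pull-back of dp /\ dq along Phi is dp /\ dq at every point of U. *)
Definition preserves_wedge (U : set 'cV[R]_(n + n))
    (Phi : 'cV[R]_(n + n) -> 'cV[R]_(n + n)) : Prop :=
  forall y, U y ->
    differentiable Phi y /\
    forall v w, wedge_pq ('d Phi y v) ('d Phi y w) = wedge_pq v w.

End Hamiltonian.

Section Wiener.
Context {d : measure_display} {Omega : measurableType d} {R : realType}.
Variable P : probability Omega R.

Definition increment (W : R -> {RV P >-> R}) (a b : R) (w : Omega) : R :=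
  W b w - W a w.

Definition standard_wiener (W : R -> {RV P >-> R}) : Prop :=
  [/\ {ae P, forall w, W 0 w = 0},
      {ae P, forall w, {within [set t : R | 0 <= t],
                        continuous (fun t => W t w)}},
      (forall a b : R, 0 <= a -> a < b ->
        forall B : set R, measurable B ->
          P (increment W a b @^-1` B)
          = normal_prob 0 (Num.sqrt (b - a)) B)
    & (forall (N : nat) (t : nat -> R),
        0 <= t 0%N -> {homo t : i j / (i <= j)%N >-> i <= j} ->
        forall B : 'I_N -> set R, (forall i, measurable (B i)) ->
          P (\bigcap_(i in [set: 'I_N]) increment W (t i) (t i.+1) @^-1` B i)
          = (\prod_(i < N) P (increment W (t i) (t i.+1) @^-1` B i))%E)].

Definition process_sigma_algebra (W : R -> {RV P >-> R}) : set (set Omega) :=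
  <<s [set A | exists2 t : R, 0 <= t &
         exists2 B : set R, measurable B & A = W t @^-1` B] >>.

Definition independent_processes (m : nat) (W : 'I_m -> R -> {RV P >-> R}) :
    Prop :=
  forall A : 'I_m -> set Omega,
    (forall r, process_sigma_algebra (W r) (A r)) ->
    P (\bigcap_(r in [set: 'I_m]) A r) = (\prod_(r < m) P (A r))%E.

(* I_r on the step from k h to (k + 1) h, for the realization w *)
Definition wiener_increment (W : R -> {RV P >-> R}) (h : R) (k : nat)
    (w : Omega) : R :=
  increment W (k%:R * h) (k.+1%:R * h) w.

(* I_{r0}: the inner stochastic integral of 1 over [t_k, s] is
   W(s) - W(t_k). *)
Definition wiener_iterated_integral (W : R -> {RV P >-> R}) (h : R) (k : nat)
    (w : Omega) : R :=
  \int[lebesgue_measure]_(s in `[k%:R * h, k.+1%:R * h])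
     increment W (k%:R * h) s w.

End Wiener.

Section StochasticRungeKutta.
Context {R : realType}.

Record srk_tableau (s : nat) := SrkTableau {
  srk_a : 'I_s -> 'I_s -> R;
  srk_b : 'I_s -> 'I_s -> R;
  srk_d : 'I_s -> 'I_s -> R;
  srk_alpha : 'I_s -> R;
  srk_beta : 'I_s -> R;
  srk_gamma : 'I_s -> R;
  srk_c : 'I_s -> R;
  srk_chat : 'I_s -> R }.

Context {n m s : nat}.
Variables (T : srk_tableau s).
Variables (f : R -> 'cV[R]_(n + n) -> 'cV[R]_(n + n)).
Variables (g : 'I_m -> R -> 'cV[R]_(n + n)).

Definition srk_stages (t h : R) (I I0 : 'I_m -> R) (y : 'cV[R]_(n + n))
    (Y : 'I_s -> 'cV[R]_(n + n)) : Prop :=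
  forall i, Y i =
    y + h *: (\sum_(j < s) srk_a T i j *: f (t + srk_c T j * h) (Y j))
      + \sum_(r < m) I r *:
          (\sum_(j < s) srk_b T i j *: g r (t + srk_chat T j * h))
      + \sum_(r < m) (I0 r / h) *:
          (\sum_(j < s) srk_d T i j *: g r (t + srk_chat T j * h)).

Definition srk_update (t h : R) (I I0 : 'I_m -> R) (y : 'cV[R]_(n + n))
    (Y : 'I_s -> 'cV[R]_(n + n)) : 'cV[R]_(n + n) :=
  y + h *: (\sum_(i < s) srk_alpha T i *: f (t + srk_c T i * h) (Y i))
    + \sum_(r < m) I r *:
        (\sum_(i < s) srk_beta T i *: g r (t + srk_chat T i * h))
    + \sum_(r < m) (I0 r / h) *:
        (\sum_(i < s) srk_gamma T i *: g r (t + srk_chat T i * h)).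

(* The method is implicit: Phi is a one-step map defined by it on the open set
   U when the stage equations are solved on U by stages depending
   differentiably on the initial value. *)
Definition srk_one_step_map (t h : R) (I I0 : 'I_m -> R)
    (U : set 'cV[R]_(n + n)) (Phi : 'cV[R]_(n + n) -> 'cV[R]_(n + n)) : Prop :=
  open U /\
  exists Y : 'I_s -> 'cV[R]_(n + n) -> 'cV[R]_(n + n),
    (forall i y, U y -> differentiable (Y i) y) /\
    (forall y, U y ->
       srk_stages t h I I0 y (Y ^~ y) /\
       Phi y = srk_update t h I I0 y (Y ^~ y)).

Definition srk_symplectic {d : measure_display} {Omega : measurableType d}
    {P : probability Omega R} (W : 'I_m -> R -> {RV P >-> R}) : Prop :=
  forall (h : R) (k : nat) (w : Omega) (U : set 'cV[R]_(n + n))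
         (Phi : 'cV[R]_(n + n) -> 'cV[R]_(n + n)),
    0 < h ->
    srk_one_step_map (k%:R * h) h
      (fun r => wiener_increment (W r) h k w)
      (fun r => wiener_iterated_integral (W r) h k w) U Phi ->
    preserves_wedge U Phi.

End StochasticRungeKutta.

(* Main.v *)
Require Import Defs.
From HB Require Import structures.
From mathcomp Require Import all_boot all_order all_algebra.
From mathcomp Require Import all_classical all_reals all_analysis.
From mathcomp Require Import ring lra.

(** Fix a realization of the noise. The noise coefficients do not depend on the
state, so in the stage and update equations the noise enters as terms constant
in the initial value [y]. Differentiating the method in a direction [v]
therefore gives exactly the deterministic Runge-Kutta scheme with tableau
[(a, alpha)] for the variational equation: with [D_i = 'd (Y i) y] and
[K_i v = f_i' (D_i v)], one has [D_i v = v + h sum_j a_ij K_j v] and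
[dPhi v = v + h sum_i alpha_i K_i v] ([is_diff_runge_kutta]).

The variational equation leaves [omega = dp /\ dq] infinitesimally invariant: the
derivative of [J^-1 grad H0] is [J^-1] times the Hessian of [H0], and symmetry
of the Hessian says precisely that
[omega (f' v, w) + omega (v, f' w) = 0] ([wedge_pq_diff_hamiltonian_field]).
Only differentiability of the gradient is available, not continuity of second
derivatives, so the Hessian is shown to be symmetric by Young's argument
([diff_derive_sym]): the symmetric second difference
[f (x+tv+tw) - f (x+tv) - f (x+tw) + f x] is [t^2 D_v D_w f x + o(t^2)]
([second_difference_approx]).

Finally, Runge-Kutta schemes satisfying
[alpha_i a_ij + alpha_j a_ji = alpha_i alpha_j] preserve every bilinear form
that is infinitesimally invariant at the stages
([runge_kutta_form_invariant]): replacing [v] and [w] in the first-order part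
of [omega (dPhi v, dPhi w)] by [D_i v - h sum_j a_ij K_j v] and its analogue for
[w] leaves only terms in [omega (K_i v, K_j w)], which cancel the second-order
part. *)

Set Implicit Arguments.
Unset Strict Implicit.
Unset Printing Implicit Defensive.

Import Order.TTheory GRing.Theory Num.Theory.
Import numFieldNormedType.Exports.

Local Open Scope classical_set_scope.
Local Open Scope ring_scope.

(** * Symmetry of second derivatives *)

Lemma derivative_along_line (R : realType) (V W : normedModType R) (f : V -> W)
    (p w : V) (s : R) :
  derivable f (p + s *: w) w ->
  is_derive s 1 (fun s : R => f (p + s *: w)) ('D_w f (p + s *: w)).
Proof.
have quotientE : (fun h : R => h^-1 *: (((fun s => f (p + s *: w)) \o shift s)
      (h *: 1) - f (p + s *: w))) =
    (fun h => h^-1 *: ((f \o shift (p + s *: w)) (h *: w) - f (p + s *: w))).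
  apply/funext => h /=; congr (_ *: (f _ - _)).
  by rewrite [h *: 1]mulr1 scalerDl addrCA.
by move=> dfw; split; rewrite /derivable /derive quotientE.
Qed.

Lemma differentiable_approx (R : realType) (V W : normedModType R) (f : V -> W)
    (x : V) (e : R) :
  differentiable f x -> 0 < e ->
  \forall u \near 0, `|f (x + u) - f x - 'd f x u| <= e * `|u|.
Proof.
move=> /diff_locally /eqaddoP fx e0.
apply: filterS (fx e e0) => u.
suff -> : f (x + u) - f x - 'd f x u = (f \o shift x - (cst (f x) + 'd f x)) u.
  by [].
by rewrite !fctE /= opprD addrA (addrC u).
Qed.

(** The mean value theorem is applied in the direction [w] to the increment of
[f] along [t *: v]; it turns the second difference into [t] times an increment
of ['D_w f], whose first-order expansion at [x] gives the main term. Since only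
that expansion is used, differentiability of ['D_w f] at the single point [x]
suffices. *)
Lemma second_difference_approx (R : realType) (V : normedModType R)
    (f : V -> R) (x v w : V) (e : R) :
  (\forall z \near x, differentiable f z) -> differentiable ('D_w f) x ->
  0 < e ->
  \forall t \near (0 : R)^'+,
    `|f (x + t *: v + t *: w) - f (x + t *: v) - f (x + t *: w) + f x
       - t ^+ 2 * 'd ('D_w f) x v| <= e * t ^+ 2.
Proof.
move=> dfx dkx e0; set k := 'D_w f; pose C := `|v| + 2 * `|w| + 1.
have C0 : 0 < C by rewrite /C ltr_wpDl// addr_ge0// mulr_ge0.
(* [C] bounds, up to the factor [t], the total size of the two increments at
   which the expansion of [k] is used: [t *: v + c *: w] and [c *: w] with
   [0 <= c <= t]; the final [+ 1] keeps it positive. *)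
have eC0 : 0 < e / C by rewrite divr_gt0.
have : \forall u \near 0, differentiable f (x + u) /\
    `|k (x + u) - k x - 'd k x u| <= e / C * `|u|.
  near=> u; split; near: u; last exact: differentiable_approx.
  move: dfx; rewrite (near_shift 0)/=; apply: filterS => u.
  by rewrite subr0 addrC.
move=> /nbhs_normP[r /= r0 rP].
near=> t.
have t0 : 0 < t by near: t; exact: nbhs_right_gt.
have tr : t < r / C by near: t; apply: nbhs_right_lt; rewrite divr_gt0.
have {}rP u : `|u| <= t * C -> differentiable f (x + u) /\
    `|k (x + u) - k x - 'd k x u| <= e / C * `|u|.
  move=> ut; apply: rP; rewrite /= sub0r normrN (le_lt_trans ut)//.
  by rewrite -ltr_pdivlMr.
pose phi s := f (x + t *: v + s *: w) - f (x + s *: w).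
pose phi' s := k (x + t *: v + s *: w) - k (x + s *: w).
have small s : s \in `[0, t] ->
    `|t *: v + s *: w| <= t * (`|v| + `|w|) /\ `|s *: w| <= t * `|w|.
  rewrite in_itv/= => /andP[s0 st].
  have sw : `|s *: w| <= t * `|w| by rewrite normrZ (ger0_norm s0) ler_wpM2r.
  split=> //; rewrite (le_trans (ler_normD _ _))// mulrDr lerD//.
  by rewrite normrZ gtr0_norm.
have smallC s : s \in `[0, t] ->
    `|t *: v + s *: w| <= t * C /\ `|s *: w| <= t * C.
  move=> /small[vw ww]; have w0 : 0 <= `|w| by [].
  have v0 : 0 <= `|v| by [].
  split; [apply: le_trans vw _|apply: le_trans ww _];
    by rewrite (ler_pM2l t0) /C; lra.
have phiD s : s \in `[0, t] -> is_derive s 1 phi (phi' s).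
  move=> /smallC[/rP[d1 _] /rP[d2 _]]; rewrite addrA in d1.
  apply: is_deriveB; apply: derivative_along_line; exact: diff_derivable.
have phi_cont : {within `[0, t], continuous phi}.
  by apply: derivable_within_continuous => s /phiD[].
have phiDo s : s \in `]0, t[ -> is_derive s 1 phi (phi' s).
  by move=> /subset_itv_oo_cc; exact: phiD.
have [c /subset_itv_oo_cc ct phit] := MVT t0 phiDo phi_cont.
have [/rP[_] + /rP[_]] := smallC _ ct.
rewrite addrA linearD [X in _ - (X + _)]linearZ/= => b1 b2.
have [n1 n2] := small _ ct.
have -> : f (x + t *: v + t *: w) - f (x + t *: v) - f (x + t *: w) + f x =
    phi' c * t.
  by move: phit; rewrite /phi !scale0r !addr0 subr0 => <-; ring.
pose E1 := k (x + t *: v + c *: w) - k x - (t * 'd k x v + 'd k x (c *: w)).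
pose E2 := k (x + c *: w) - k x - 'd k x (c *: w).
have -> : phi' c * t - t ^+ 2 * 'd k x v = t * (E1 - E2).
  by rewrite /phi' /E1 /E2; ring.
rewrite normrM gtr0_norm// expr2 mulrCA ler_pM2l//.
apply: le_trans (ler_normB _ _) _; apply: le_trans (lerD b1 b2) _.
rewrite -mulrDr -mulrA ler_pM2l// mulrC ler_pdivrMr//.
apply: le_trans (lerD n1 n2) _.
by rewrite -mulrDr ler_pM2l// /C; lra.
Unshelve. all: by end_near. Qed.

(** The second difference is symmetric in [v] and [w], hence so is its leading
coefficient. *)
Lemma diff_derive_sym (R : realType) (V : normedModType R) (f : V -> R)
    (x v w : V) :
  (\forall z \near x, differentiable f z) ->
  differentiable ('D_v f) x -> differentiable ('D_w f) x ->
  'd ('D_w f) x v = 'd ('D_v f) x w.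
Proof.
move=> dfx dv dw; apply/eqP; rewrite -subr_eq0 -normr_le0.
apply/ler_addgt0Pr => e e0; rewrite add0r.
have e20 : 0 < e / 2 by rewrite divr_gt0.
near (0 : R)^'+ => t.
have t0 : 0 < t ^+ 2 by rewrite exprn_gt0//; near: t; exact: nbhs_right_gt.
have A : `|f (x + t *: v + t *: w) - f (x + t *: v) - f (x + t *: w) + f x
       - t ^+ 2 * 'd ('D_w f) x v| <= e / 2 * t ^+ 2.
  by near: t; exact: second_difference_approx.
have B : `|f (x + t *: w + t *: v) - f (x + t *: w) - f (x + t *: v) + f x
       - t ^+ 2 * 'd ('D_v f) x w| <= e / 2 * t ^+ 2.
  by near: t; exact: second_difference_approx.
rewrite (addrAC x (t *: w)) (addrAC _ (- f (x + t *: w))) distrC in B.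
rewrite -(ler_pM2r t0) -[X in `|_| * X](gtr0_norm t0) -normrM.
rewrite [e]splitr (mulrDl (e / 2)) -normrN; apply: le_trans (lerD A B).
apply: le_trans _ (ler_normD _ _).
by rewrite le_eqVlt; apply/orP; left; apply/eqP; congr `|_|; ring.
Unshelve. all: by end_near. Qed.

(** * Differentiation rules *)

(** Allows differentiating an equation between functions that holds only on an
open set. *)
Lemma near_eq_is_diff (R : numFieldType) (V W : normedModType R)
    (f g df : V -> W) (x : V) :
  (\forall z \near x, f z = g z) -> is_diff x f df -> is_diff x g df.
Proof.
move=> fg [dfx dfE].
have gx : g \o shift x = cst (g x) + 'd f x +o_ 0 id.
  apply/eqaddoP => e e0.
  have /diff_locally/eqaddoP/(_ e e0) := dfx.
  have fgx : f x = g x by exact: nbhs_singleton fg.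
  move: fg; rewrite (near_shift 0) => /= fg.
  apply: filterS2 fg => u; rewrite subr0 => fgu.
  by rewrite !fctE /= fgx fgu.
have dgE := diff_unique (diff_continuous dfx) gx.
split; last by rewrite dgE.
by apply/diff_locallyP; rewrite dgE; split=> //; exact: diff_continuous.
Qed.

Lemma is_diff_sum (R : numFieldType) (V W : normedModType R) (I : Type)
    (r : seq I) (f df : I -> V -> W) (x : V) :
  (forall i, is_diff x (f i) (df i)) ->
  is_diff x (\sum_(i <- r) f i) (\sum_(i <- r) df i).
Proof.
move=> fdf; apply: (big_ind2 (fun g dg => is_diff x g dg)) => //.
  exact: is_diff_cst.
by move=> g1 dg1 g2 dg2 d1 d2; exact: is_diffD.
Qed.

Lemma is_diff_mulmx (R : realType) (m n : nat) (A : 'M[R]_(m, n))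
    (x : 'cV[R]_n) :
  is_diff x (mulmx A : 'cV_n -> 'cV_m) (mulmx A).
Proof.
have dA z : differentiable (mulmx A : 'cV[R]_n -> 'cV[R]_m) z.
  have -> : mulmx A = \sum_j (fun z : 'cV[R]_n => z j 0 *: col j A).
    apply/funext => u; apply/matrixP => i k; rewrite fct_sumE summxE mxE.
    by apply: eq_bigr => j _; rewrite !mxE ord1 mulrC.
  apply: differentiable_sum => j.
  by apply: differentiableZl; exact: differentiable_coord.
split; first exact: dA.
by rewrite diff_lin// => z; exact: differentiable_continuous.
Qed.

(** * The symplectic form and Hamiltonian vector fields *)

Lemma wedge_pq_is_bilinear (R : realType) (n : nat) :
  bilinear_for (GRing.Scale.Law.clone _ _ *%R _)
    (GRing.Scale.Law.clone _ _ *%R _) (@wedge_pq R n).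
Proof.
split=> u a x y; rewrite /wedge_pq /= mulr_sumr -big_split /=;
  by apply: eq_bigr => i _; rewrite !mxE; ring.
Qed.

HB.instance Definition _ (R : realType) (n : nat) :=
  bilinear_isBilinear.Build R 'cV[R]_(n + n) 'cV[R]_(n + n) R _ _
    (@wedge_pq R n) (@wedge_pq_is_bilinear R n).

Lemma wedge_pqC (R : realType) (n : nat) (v w : 'cV[R]_(n + n)) :
  wedge_pq w v = - wedge_pq v w.
Proof.
by rewrite /wedge_pq -sumrN; apply: eq_bigr => i _; rewrite opprB.
Qed.

Lemma invmx_Jmx (R : realType) (n : nat) : invmx (@Jmx R n) = - Jmx.
Proof.
have JJ : (- Jmx) *m @Jmx R n = 1%:M.
  rewrite /Jmx opp_block_mx mulmx_block !oppr0 !mulmx0 !mul0mx !addr0 !add0r.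
  by rewrite !mulNmx !mul1mx !opprK -scalar_mx_block.
have [_ JJ'] := mulmx1_unit JJ.
by rewrite -[LHS]mul1mx -JJ -mulmxA mulmxV// mulmx1.
Qed.

(** As [J^-1 = - J], the matrix [J] of the symplectic form cancels; with [a] a
gradient, this says that a Hamiltonian field contracts [dp /\ dq] to [- dH]. *)
Lemma wedge_pq_invmx_Jmx (R : realType) (n : nat) (a w : 'cV[R]_(n + n)) :
  wedge_pq (invmx Jmx *m a) w = - \sum_i w i 0 * a i 0.
Proof.
rewrite invmx_Jmx -[a]vsubmxK mulNmx mul_block_col !mul0mx mulNmx !mul1mx.
rewrite add0r addr0 opp_col_mx opprK.
rewrite /wedge_pq big_split_ord/= -big_split -sumrN.
apply: eq_bigr => i _ /=.
by rewrite !col_mxEu !col_mxEd !mxE; ring.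
Qed.

Section HamiltonianField.
Context {R : realType} {n : nat}.
Implicit Types (H : 'cV[R]_(n + n) -> R) (x v w : 'cV[R]_(n + n)).

Lemma derive_gradient H x w :
  differentiable H x -> 'D_w H x = \sum_i w i 0 * gradient H x i 0.
Proof.
move=> dH; rewrite deriveE// {1}[w]matrix_sum_delta linear_sum/=.
apply: eq_bigr => i _; rewrite big_ord1 linearZ/= mxE deriveE//.
Qed.

Lemma derivable_gradient_coord H x v i :
  differentiable (gradient H) x ->
  derivable (fun z => gradient H z i 0) x v.
Proof.
by move=> dG; have /derivable_mxP := @diff_derivable _ _ _ _ _ v dG; apply.
Qed.

Lemma diff_derive_gradient H x v w :
  (forall z, differentiable H z) -> differentiable (gradient H) x ->
  differentiable ('D_w H) x /\
  'd ('D_w H) x v = \sum_i w i 0 * 'd (gradient H) x v i 0.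
Proof.
move=> dH dG.
have -> : 'D_w H = \sum_i w i 0 *: (fun z => gradient H z i 0).
  apply/funext => z; rewrite derive_gradient// fct_sumE.
  by apply: eq_bigr => i _.
have dD : differentiable (\sum_i w i 0 *: (fun z => gradient H z i 0)) x.
  apply: differentiable_sum => i; apply: differentiableZ.
  exact: (differentiable_comp dG (differentiable_coord _ i 0)).
split=> //; rewrite -deriveE// derive_sum; last first.
  by move=> i; apply: derivableZ; exact: derivable_gradient_coord.
apply: eq_bigr => i _; rewrite deriveZ; last exact: derivable_gradient_coord.
by rewrite -[in RHS]deriveE// derive_mx ?mxE//; exact: diff_derivable.
Qed.

Lemma is_diff_hamiltonian_field H x :
  differentiable (gradient H) x ->
  is_diff x (hamiltonian_field H)
    (fun v => invmx Jmx *m 'd (gradient H) x v).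
Proof.
move=> /differentiableP dG.
exact: (is_diff_comp dG (is_diff_mulmx _ _)).
Qed.

(** The linearization of a Hamiltonian field belongs to the Lie algebra of the
symplectic group, because both terms are, up to opposite signs, the Hessian of
[H] applied to [v] and [w]. *)
Lemma wedge_pq_diff_hamiltonian_field H x v w :
  (forall z, differentiable H z) -> differentiable (gradient H) x ->
  wedge_pq ('d (hamiltonian_field H) x v) w
    + wedge_pq v ('d (hamiltonian_field H) x w) = 0.
Proof.
move=> dH dG; have [dv dvE] := diff_derive_gradient w v dH dG.
have [dw dwE] := diff_derive_gradient v w dH dG.
have [_ dF] := is_diff_hamiltonian_field dG.
rewrite [X in _ + X]wedge_pqC dF.
have hessian_symmetric : 'd ('D_w H) x v = 'd ('D_v H) x w.
  by apply: (diff_derive_sym _ dv dw); exact: filterE.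
rewrite !wedge_pq_invmx_Jmx opprK.
by rewrite (etrans (esym dwE) (etrans hessian_symmetric dvE)) addNr.
Qed.

End HamiltonianField.

(** * Runge-Kutta schemes *)

(** [K] and [L] are the slopes of the scheme started at [v] and at [w]. The
hypothesis on slopes is infinitesimal invariance of [omega] at each stage; with
it, the first-order terms become quadratic in the slopes, and the condition on
the tableau makes them cancel the second-order ones. *)
Lemma runge_kutta_form_invariant (R : comNzRingType) (V : lmodType R)
    (omega : {biscalar V}) (s : nat) (a : 'I_s -> 'I_s -> R) (alpha : 'I_s -> R)
    (h : R) (v w : V) (K L : 'I_s -> V) :
  (forall i j, alpha i * a i j + alpha j * a j i = alpha i * alpha j) ->
  (forall i, omega (K i) (w + h *: \sum_j a i j *: L j)
           + omega (v + h *: \sum_j a i j *: K j) (L i) = 0) ->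
  omega (v + h *: \sum_i alpha i *: K i) (w + h *: \sum_i alpha i *: L i)
    = omega v w.
Proof.
move=> haa hKL.
pose B i j := omega (K i) (L j).
have slope i : omega (K i) w + omega v (L i)
    = - (h * \sum_j a i j * (B i j + B j i)).
  apply/eqP; rewrite -addr_eq0 -[X in _ == X](hKL i) linearDr linearDl.
  rewrite linearZr_LR linearZl_LR linear_sumr linear_sumlz /= addrACA -mulrDr.
  rewrite -big_split/=; apply/eqP; congr (_ + _ * _); apply: eq_bigr => j _.
  by rewrite linearZr_LR linearZl_LR /= mulrDr.
have first_order : \sum_i alpha i * (omega (K i) w + omega v (L i))
    = - (h * \sum_i \sum_j alpha i * alpha j * B i j).
  under eq_bigr do rewrite slope mulrN mulrCA.
  rewrite sumrN -mulr_sumr; congr (- (_ * _)).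
  under eq_bigr do rewrite mulr_sumr.
  under eq_bigr do under eq_bigr do rewrite mulrDr mulrDr.
  under eq_bigr do rewrite big_split.
  rewrite big_split/= [X in _ + X]exchange_big/= -big_split/=.
  apply: eq_bigr => i _; rewrite -big_split/=; apply: eq_bigr => j _.
  by rewrite -haa; ring.
rewrite linearDl !linearDr !linearZl_LR !linearZr_LR/= linear_sumr !linear_sumlz.
have -> : \sum_i omega (alpha i *: K i) (\sum_j alpha j *: L j)
    = \sum_i \sum_j alpha i * alpha j * B i j.
  apply: eq_bigr => i _; rewrite linear_sumr; apply: eq_bigr => j _.
  by rewrite linearZl_LR linearZr_LR /= mulrA.
have linear_terms :
    \sum_i omega v (alpha i *: L i) + \sum_i omega (alpha i *: K i) w
    = \sum_i alpha i * (omega (K i) w + omega v (L i)).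
  rewrite -big_split; apply: eq_bigr => i _.
  by rewrite linearZl_LR linearZr_LR /= -mulrDr addrC.
rewrite -addrA [X in _ + X]addrA -mulrDr linear_terms first_order.
by rewrite mulrN mulrA addNr addr0.
Qed.

(** [k] and [l] stand for the two groups of noise terms, which disappear under
differentiation. *)
Lemma is_diff_runge_kutta (R : realType) (V : normedModType R) (s : nat)
    (F Y : 'I_s -> V -> V) (c : 'I_s -> R) (h : R) (k l y : V) :
  (forall i, differentiable (Y i) y) ->
  (forall i, differentiable (F i) (Y i y)) ->
  is_diff y (fun z => z + h *: (\sum_i c i *: F i (Y i z)) + k + l)
    (fun v => v + h *: \sum_i c i *: 'd (F i) (Y i y) ('d (Y i) y v)).
Proof.
move=> dY dF.
have dFY i : is_diff y (c i *: (F i \o Y i))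
    (c i *: ('d (F i) (Y i y) \o 'd (Y i) y)).
  by apply: is_diffZ; apply: is_diff_comp; exact: differentiableP.
have dsum := is_diffZ h (is_diff_sum (index_enum 'I_s) dFY).
have dyk := is_diffD (is_diffD (is_diff_id y) dsum) (is_diff_cst k y).
have := is_diffD dyk (is_diff_cst l y).
congr (is_diff y _ _).
  by apply/funext => z; rewrite !fctE fct_sumE.
by apply/funext => v; rewrite !fctE fct_sumE !addr0.
Qed.

Theorem theorem4p1 (R : realType) (n m s : nat)
    (d : measure_display) (Omega : measurableType d) (P : probability Omega R)
    (W : 'I_m -> R -> {RV P >-> R})
    (H0 : R -> 'cV[R]_(n + n) -> R)
    (H : 'I_m -> R -> 'cV[R]_(n + n) -> R)
    (g : 'I_m -> R -> 'cV[R]_(n + n))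
    (T : srk_tableau s)
    (hW : forall r, standard_wiener (W r))
    (hWind : independent_processes W)
    (hH0 : forall t x, differentiable (H0 t) x)
    (hH02 : forall t x, differentiable (gradient (H0 t)) x)
    (hH : forall r t x, differentiable (H r t) x)
    (hg : forall r t x, g r t = hamiltonian_field (H r t) x)
    (hT : forall i j : 'I_s,
       srk_alpha T i * srk_a T i j + srk_alpha T j * srk_a T j i
       = srk_alpha T i * srk_alpha T j) :
  srk_symplectic T (fun t => hamiltonian_field (H0 t)) g W.
Proof.
move=> h k w U Phi _ [Uopen [Y [dY stagesY]]] y Uy.
set t := k%:R * h in stagesY.
pose F i := hamiltonian_field (H0 (t + srk_c T i * h)).
have dF i x : differentiable (F i) x.
  by have [] := is_diff_hamiltonian_field (hH02 (t + srk_c T i * h) x).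
have near_U : \forall z \near y, U z by exact: open_nbhs_nbhs.
(* The stage equations are implicit in [Y], but they are identities in the
   initial value on [U], so both sides have the same differential at [y]. *)
have diff_Phi : is_diff y Phi (fun v =>
    v + h *: \sum_i srk_alpha T i *: 'd (F i) (Y i y) ('d (Y i) y v)).
  apply: near_eq_is_diff (is_diff_runge_kutta _ _ _ _ _ _) => //; last first.
    by move=> i; exact: dY.
  by apply: filterS near_U => z Uz; have [_ ->] := stagesY z Uz.
have diff_Y i : is_diff y (Y i) (fun v =>
    v + h *: \sum_j srk_a T i j *: 'd (F j) (Y j y) ('d (Y j) y v)).
  apply: near_eq_is_diff (is_diff_runge_kutta _ _ _ _ _ _) => //; last first.
    by move=> j; exact: dY.
  by apply: filterS near_U => z Uz; have [/(_ i) ->] := stagesY z Uz.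
have [dPhi dPhiE] := diff_Phi; split=> // u v; rewrite dPhiE.
apply: (runge_kutta_form_invariant hT) => i.
have := wedge_pq_diff_hamiltonian_field ('d (Y i) y u) ('d (Y i) y v)
  (hH0 (t + srk_c T i * h)) (hH02 (t + srk_c T i * h) (Y i y)).
have dYE z : 'd (Y i) y z =
    z + h *: \sum_j srk_a T i j *: 'd (F j) (Y j y) ('d (Y j) y z).
  by have [_ E] := diff_Y i; exact: (congr1 (fun D => D z) E).
by rewrite [X in wedge_pq _ X + _]dYE [X in _ + wedge_pq X _]dYE.
Qed.
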